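(* Let $R$ be a semiprime ring, let $I$ be a nonzero ideal of $R$, and let $d:R\to R$ be a multiplicative semiderivation associated with a nonzero epimorphism $g$ of $R$. If $d(x)d(y)\pm yx=0$ for all $x,y\in I$ (that is, either $d(x)d(y)+yx=0$ for all $x,y\in I$, or $d(x)d(y)-yx=0$ for all $x,y\in I$), then $[x,d(x)]=0$ for all $x\in I$.
   Context: Rings are associative and not assumed unital or commutative; ideals are two-sided. A ring $R$ is semiprime if for $x\in R$, $xRx=0$ implies $x=0$. For $x,y\in R$, $[x,y]=xy-yx$. A mapping $d:R\to R$ (not assumed additive) is a multiplicative semiderivation associated with a function $g:R\to R$ if (i) $d(xy)=d(x)g(y)+xd(y)=d(x)y+g(x)d(y)$ and (ii) $d(g(x))=g(d(x))$ hold for all $x,y\in R$. An epimorphism of $R$ is a surjective ring homomorphism $R\to R$; nonzero means not the zero map. *)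

(* Defs.v *)
From HB Require Import structures.
From mathcomp Require Import all_boot all_algebra.

Set Implicit Arguments.
Unset Strict Implicit.
Unset Printing Implicit Defensive.

Import GRing.Theory.

Local Open Scope ring_scope.

(* "*" is taken by the product of unital rings, GRing.mul; the product here is
   that of the underlying semigroup. *)
Notation "x ** y" := (monoid.mul x y)
  (at level 40, left associativity) : ring_scope.

(* Associative rings, not assumed unital or commutative. *)
HB.mixin Record Zmodule_Semigroup_isRng R
    of GRing.Zmodule R & monoid.Semigroup R := {
  rng_mulDl : left_distributive (@monoid.mul R) +%R;
  rng_mulDr : right_distributive (@monoid.mul R) +%R
}.

#[short(type="rngType")]
HB.structure Definition Rng :=
  {R of Zmodule_Semigroup_isRng R & GRing.Zmodule R & monoid.Semigroup R}.

Bind Scope ring_scope with Rng.sort.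

Section RngNotions.
Variable R : rngType.
Implicit Types (I : R -> Prop) (d g : R -> R).

Definition semiprime_rng : Prop :=
  forall x : R, (forall r : R, x ** r ** x = 0) -> x = 0.

Definition commutator (x y : R) : R := x ** y - y ** x.

Definition is_ideal I : Prop :=
  [/\ I 0,
      forall x y, I x -> I y -> I (x - y),
      forall r x, I x -> I (r ** x)
    & forall r x, I x -> I (x ** r)].

Definition nonzero_ideal I : Prop := is_ideal I /\ exists2 x, I x & x <> 0.

Definition rng_morphism g : Prop :=
  GRing.zmod_morphism g /\ {morph g : x y / x ** y}.

Definition rng_epimorphism g : Prop :=
  rng_morphism g /\ forall y, exists x, g x = y.

Definition nonzero_map g : Prop := exists x, g x <> 0.

(* d is not assumed additive. *)
Definition multiplicative_semiderivation d g : Prop :=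
  [/\ forall x y, d (x ** y) = d x ** g y + x ** d y,
      forall x y, d (x ** y) = d x ** y + g x ** d y
    & forall x, d (g x) = g (d x)].

End RngNotions.

Arguments semiprime_rng : clear implicits.

(* Main.v *)
Require Import Defs.
From mathcomp Require Import all_boot all_algebra.
Local Open Scope ring_scope.

(** Write [d x ** d y = e (y ** x)] with [e] a sign.  Replacing [y] by
    [y ** r] gives [d x ** y ** d r = e (y ** (r ** x - x ** g r))]; inserting
    a further factor [d w] and multiplying by [d v] then eliminates [d]
    altogether, leaving [[y r x, t] = [y x, t] g r] on [I].  Computing
    [[y r s x, t]] in two ways and using the surjectivity of [g], one gets
    [[y x, t] [p, q] = 0] for all [p], [q] in [R], so by semiprimeness [I] is
    commutative, hence central in [R]. *)

Set Implicit Arguments.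
Unset Strict Implicit.
Unset Printing Implicit Defensive.

Import GRing.Theory.

Section RngTheory.
Variable R : rngType.
Implicit Types x y z : R.

Lemma rng_mulA x y z : x ** (y ** z) = x ** y ** z.
Proof. exact: monoid.mulgA. Qed.

Lemma rng_mul0 x : 0 ** x = 0.
Proof. by apply: (addrI (0 ** x)); rewrite -rng_mulDl !addr0. Qed.

Lemma rng_mulr0 x : x ** 0 = 0.
Proof. by apply: (addrI (x ** 0)); rewrite -rng_mulDr !addr0. Qed.

Lemma rng_mulNl x y : (- x) ** y = - (x ** y).
Proof. by apply: (addrI (x ** y)); rewrite -rng_mulDl !subrr rng_mul0. Qed.

Lemma rng_mulNr x y : x ** (- y) = - (x ** y).
Proof. by apply: (addrI (x ** y)); rewrite -rng_mulDr !subrr rng_mulr0. Qed.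

Lemma rng_mulBl x y z : (x - y) ** z = x ** z - y ** z.
Proof. by rewrite rng_mulDl rng_mulNl. Qed.

Lemma rng_mulBr x y z : x ** (y - z) = x ** y - x ** z.
Proof. by rewrite rng_mulDr rng_mulNr. Qed.

(** Lets both sign cases run through one argument; [b = true] is the case
    [d x ** d y + y ** x = 0]. *)
Definition signed (b : bool) x := if b then - x else x.

Lemma signed_mull b x y : signed b x ** y = signed b (x ** y).
Proof. by case: b; rewrite //= rng_mulNl. Qed.

Lemma signed_mulr b x y : x ** signed b y = signed b (x ** y).
Proof. by case: b; rewrite //= rng_mulNr. Qed.

Lemma signedB b x y : signed b (x - y) = signed b x - signed b y.
Proof. by case: b; rewrite //= opprD. Qed.

Lemma signed_inj b : injective (signed b).
Proof. by case: b => x y //= /oppr_inj. Qed.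

Lemma commutatorMl x y z :
  commutator (x ** y) z = x ** commutator y z + commutator x z ** y.
Proof. by rewrite /commutator rng_mulBr rng_mulBl !rng_mulA addrA subrK. Qed.

Lemma commutatorMr x y z :
  commutator x (y ** z) = commutator x y ** z + y ** commutator x z.
Proof. by rewrite /commutator rng_mulBr rng_mulBl !rng_mulA addrA subrK. Qed.

Section Ideal.
Hypothesis hR : semiprime_rng R.
Variable I : R -> Prop.
Hypothesis hI : is_ideal I.

Let IB x y : I x -> I y -> I (x - y). Proof. by case: hI => _ H _ _; apply: H. Qed.
Let IMl r x : I x -> I (r ** x). Proof. by case: hI => _ _ H _; apply: H. Qed.
Let IMr r x : I x -> I (x ** r). Proof. by case: hI => _ _ _ H; apply: H. Qed.

(** For every [r] the product [(x - y) ** r] lies in [I], so it serves as [w] and gives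
    [(x - y) ** r ** (x - y) = 0]. *)
Lemma semiprime_ideal_cancel x y :
  I x -> I y -> (forall w, I w -> w ** x = w ** y) -> x = y.
Proof.
move=> Ix Iy H; apply/eqP; rewrite -subr_eq0; apply/eqP; apply: hR => r.
have Ixy := IB Ix Iy.
by rewrite rng_mulBr H ?subrr //; apply: IMr.
Qed.

Lemma semiprime_ideal_eq0 x : I x -> (forall w, I w -> w ** x = 0) -> x = 0.
Proof. by move=> Ix H; apply: hR => r; apply: H; apply: IMr. Qed.

Lemma commutative_ideal_central :
  (forall x y, I x -> I y -> commutator x y = 0) ->
  forall x r, I x -> commutator x r = 0.
Proof.
move=> comI x r Ix.
apply: semiprime_ideal_eq0 => [|w Iw]; first by apply: IB; [apply: IMr|apply: IMl].
(* Expanding [[x, w r] = [x, w] r + w [x, r]] leaves [w [x, r] = 0]. *)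
have := comI x (w ** r) Ix (IMr _ Iw).
by rewrite commutatorMr (comI x w Ix Iw) rng_mul0 add0r.
Qed.

Lemma ideal_commutative_of_triple :
  (forall x y t, I x -> I y -> I t -> commutator (y ** x) t = 0) ->
  forall x t, I x -> I t -> commutator x t = 0.
Proof.
move=> com3 x t Ix It.
have Ic : I (commutator x t) by apply: IB; apply: IMl.
apply: semiprime_ideal_eq0 => // z Iz.
apply: semiprime_ideal_eq0 => [|y Iy]; first exact: IMl.
(* In [[(y z) x, t]] the term [[y z, t] x] vanishes too, so [y z [x, t] = 0]; [y] and [z] are then
   cancelled in turn. *)
have := com3 x (y ** z) t Ix (IMr _ Iy) It.
by rewrite commutatorMl (com3 z y t) // rng_mul0 addr0 rng_mulA.
Qed.

(** Taking [p = x], [q = r y] and expanding [[x, r y]] isolates [[x, y] r [x, y] = 0]. *)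
Lemma commutator_annihilator_eq0 x y :
  (forall p q, commutator x y ** commutator p q = 0) -> commutator x y = 0.
Proof.
move=> H; apply: hR => r.
have := H x (r ** y).
by rewrite commutatorMr rng_mulDr !rng_mulA H rng_mul0 add0r.
Qed.

Section Semiderivation.
Variables (d g : R -> R) (b : bool).
Hypothesis hg : rng_epimorphism g.
Hypothesis dM : forall x y, d (x ** y) = d x ** g y + x ** d y.
Hypothesis hd : forall x y, I x -> I y -> d x ** d y = signed b (y ** x).

(** The defect in moving [r] past [x] with twist [g]; it is free of [d] and, for [x] in [I], stays
    in [I], so cancellation applies to it. *)
Let D r x := r ** x - x ** g r.

Let ID r x : I x -> I (D r x).
Proof. by move=> Ix; apply: IB; [apply: IMl|apply: IMr]. Qed.

Lemma semider_mid x y r :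
  I x -> I y -> d x ** y ** d r = signed b (y ** D r x).
Proof.
move=> Ix Iy; have := hd Ix (IMr r Iy).
rewrite dM rng_mulDr !rng_mulA hd // signed_mull => E.
by rewrite /D rng_mulBr signedB !rng_mulA -E addrC addKr.
Qed.

Lemma semider_swap v y x r :
  I v -> I y -> I x -> v ** y ** D r x = x ** y ** D r v.
Proof.
move=> Iv Iy Ix; apply: semiprime_ideal_cancel => [||w Iw].
- by apply: IMl; apply: ID.
- by apply: IMl; apply: ID.
(* [semider_mid] with [d w ** y] as middle factor; the product [d x ** d w] on its left collapses to
   a signed [w ** x]. *)
have E : w ** x ** y ** d r = d w ** y ** D r x.
  apply: (@signed_inj b).
  have := semider_mid r Ix (IMl (d w) Iy).
  by rewrite !rng_mulA hd // !signed_mull.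
apply: (@signed_inj b); rewrite !rng_mulA.
(* The left side is evaluated by [semider_mid] with middle factor [w ** x ** y], the right side by
   [hd] on [d v ** d w]. *)
have Ev : d v ** (w ** x ** y ** d r) = d v ** (d w ** y ** D r x) by rewrite E.
rewrite !rng_mulA hd // !signed_mull in Ev.
have := semider_mid r Iv (IMl (w ** x) Iy).
by rewrite !rng_mulA Ev.
Qed.

Lemma semider_commutator y r x t : I y -> I x -> I t ->
  commutator (y ** r ** x) t = commutator (y ** x) t ** g r.
Proof.
move=> Iy Ix It.
(* After left multiplication by [v], [semider_swap] turns both sides into [x ** t ** y ** D r v]. *)
have E : y ** D r (x ** t) = t ** y ** D r x.
  apply: semiprime_ideal_cancel => [||v Iv].
  - by apply: IMr.
  - by apply: IMl; apply: ID.
  rewrite rng_mulA (semider_swap r Iv Iy (IMr t Ix)).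
  have := semider_swap r Iv (IMl t Iy) Ix.
  by rewrite !rng_mulA => ->.
move: E; rewrite /D /commutator !rng_mulBr rng_mulBl !rng_mulA => /eqP.
rewrite subr_eq -addrA => /eqP ->.
by rewrite addrC addrK addrC.
Qed.

Lemma semider_ideal_central x r : I x -> commutator x r = 0.
Proof.
apply: commutative_ideal_central; apply: ideal_commutative_of_triple.
move=> {}x y t Ix Iy It; apply: commutator_annihilator_eq0 => p' q'.
case: hg => _ gsurj.
have [p <-] := gsurj p'; have [q <-] := gsurj q'.
(* [[y p q x, t]] equals [[y x, t] g(q) g(p)] if [p] is extracted first, and [[y x, t] g(p) g(q)] if
   [q] is. *)
have E := semider_commutator p Iy (IMl q Ix) It.
rewrite !rng_mulA (semider_commutator q (IMr p Iy) Ix It) in E.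
rewrite (semider_commutator p Iy Ix It) (semider_commutator q Iy Ix It) in E.
by rewrite {2}/commutator rng_mulBr !rng_mulA E subrr.
Qed.

End Semiderivation.
End Ideal.
End RngTheory.

Theorem theorem6 (R : rngType) (hR : semiprime_rng R)
    (I : R -> Prop) (hI : nonzero_ideal I)
    (d g : R -> R)
    (hg : rng_epimorphism g) (hg0 : nonzero_map g)
    (hd : multiplicative_semiderivation d g)
    (h : (forall x y : R, I x -> I y -> d x ** d y + y ** x = 0) \/
         (forall x y : R, I x -> I y -> d x ** d y - y ** x = 0)) :
  forall x : R, I x -> commutator x (d x) = 0.
Proof.
move=> x Ix; case: hI => idI _; case: hd => dM _ _.
have [b hb] : exists b, forall x y, I x -> I y -> d x ** d y = signed b (y ** x).
  case: h => h; [exists true | exists false] => u v Iu Iv /=.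
    by apply/eqP; rewrite -addr_eq0 h.
  by apply/eqP; rewrite -subr_eq0 h.
exact: (semider_ideal_central hR idI hg dM hb).
Qed.
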